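(* Let $\eta\ge 1$ and $l\ge 1$ be integers, and let $G=W'(\eta,1,l)$ be a generalized windmill graph of Type I with $k=1$. Then for every integer $q\ge 0$, $$Z_q(G)=\begin{cases} l & \text{if } \eta=1,\\ l+\eta-2 & \text{if } q>0 \text{ and } \eta>1,\\ l & \text{if } q=0.\end{cases}$$
   Context: Graphs are finite, simple and undirected. The generalized windmill graph of Type I, $W'(\eta,k,l)$, consists of $\eta$ disjoint copies of the complete graph $K_k$ (with no edges between different copies) together with $l$ central vertices, where every central vertex is adjacent to every vertex of every copy of $K_k$, and the $l$ central vertices are pairwise adjacent (they form a clique $K_l$). The $q$-analogue of zero forcing ($Z_q$ game), for a fixed integer $q\ge 0$, is a game between a player and an oracle on a graph $G$. Initially all vertices are unfilled. The player repeatedly uses the following rules. Rule 1: fill any vertex at the cost of one token. Rule 2 (forcing rule): at no cost, a filled vertex with a unique unfilled neighbor forces that neighbor to be filled. Rule 3: let $F$ be the set of filled vertices and let $U_1,\dots,U_r$ be the connected components of $G[V\setminus F]$; if $r>q$, the player selects at least $q+1$ of the components $U_i$; the oracle then chooses a nonempty subset $\{U_{i_1},\dots,U_{i_s}\}$ of the selected components; the player may then, at no cost, apply the forcing rule in the subgraph of $G$ induced by $F\cup U_{i_1}\cup\dots\cup U_{i_s}$. The number $Z_q(G)$ is the minimum number of tokens with which the player can guarantee to fill all vertices of $G$, against an oracle trying to maximize the number of tokens spent. *)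

(* Defs.v *)
From HB Require Import structures.
From mathcomp Require Import all_boot.
From mathcomp Require Import boolp.

Set Implicit Arguments.
Unset Strict Implicit.
Unset Printing Implicit Defensive.

Record sgraph := SGraph {
  vertex :> finType;
  adj : rel vertex;
  adj_sym : symmetric adj;
  adj_irr : irreflexive adj }.

Section Windmill.
Variables eta k l : nat.

(* [inl (i, a)] is the vertex [a] of the [i]-th copy of [K_k];
   [inr c] is a central vertex. *)
Definition windmill1_adj : rel ('I_eta * 'I_k + 'I_l)%type :=
  fun x y => match x, y with
  | inl (i, a), inl (j, b) => (i == j) && (a != b)
  | inl _, inr _ => true
  | inr _, inl _ => true
  | inr c, inr d => c != d
  end.

Lemma windmill1_adj_sym : symmetric windmill1_adj.
Proof.
move=> [[i a]|c] [[j b]|d] //=; last by rewrite eq_sym.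
by rewrite (eq_sym i) (eq_sym a).
Qed.

Lemma windmill1_adj_irr : irreflexive windmill1_adj.
Proof. by move=> [[i a]|c] //=; rewrite !eqxx. Qed.

Definition windmill1 : sgraph := SGraph windmill1_adj_sym windmill1_adj_irr.

End Windmill.

Section Game.
Variable G : sgraph.
Implicit Types (F W : {set G}) (S O : {set {set G}}).

(* Vertex sets of the connected components of [G[V \ F]]. *)
Definition components F : {set {set G}} :=
  equivalence_partition
    (connect [rel x y : G | [&& adj x y, x \notin F & y \notin F]]) (~: F).

(* With filled set [F], the vertex [u] forces [v] in the induced subgraph
   [G[W]]. *)
Definition forces W F (u v : G) : bool :=
  [&& u \in W, u \in F & [set w in W | adj u w && (w \notin F)] == [set v]].

Definition force_step W : rel {set G} :=
  fun F F' => [exists u, exists v, forces W F u v && (F' == v |: F)].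

(* [wins q t F]: starting from the filled set [F] with [t] tokens available,
   the player can guarantee to fill every vertex. In [wins_oracle], [S] is the
   player's selection, [O] ranges over the oracle's possible answers, and
   [next O] is the filled set after the (zero or more) forces the player
   chooses to perform in [G[F :|: cover O]] in response to [O]. *)
Inductive wins (q : nat) : nat -> {set G} -> Prop :=
| wins_done t : wins q t [set: G]
| wins_fill t F v : wins q t (v |: F) -> wins q t.+1 F
| wins_force t F F' : force_step [set: G] F F' -> wins q t F' -> wins q t F
| wins_oracle t F S (next : {set {set G}} -> {set G}) :
    S \subset components F -> q < #|S| ->
    (forall O, O \subset S -> O != set0 ->
       connect (force_step (F :|: cover O)) F (next O)) ->
    (forall O, O \subset S -> O != set0 -> wins q t (next O)) ->
    wins q t F.

Lemma wins_exists q : exists t, `[< wins q t set0 >].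
Proof.
suff H n F : #|~: F| = n -> wins q n F.
  by exists #|~: (set0 : {set G})|; apply/asboolP/H.
elim: n F => [|n IHn] F.
  by move/eqP; rewrite cards_eq0 => /eqP F0; rewrite -[F]setCK F0 setC0; exact: wins_done.
move=> Fn; have /card_gt0P[v vF] : 0 < #|~: F| by rewrite Fn.
apply: (@wins_fill _ _ _ v); apply: IHn; apply: succn_inj.
by rewrite -Fn (cardsD1 v (~: F)) vF setCU setIC -setDE.
Qed.

Definition Zq (q : nat) : nat := ex_minn (wins_exists q).

End Game.

(* Main.v *)
Require Import Defs.
From mathcomp Require Import all_boot.
From mathcomp Require Import boolp zify.

Set Implicit Arguments.
Unset Strict Implicit.
Unset Printing Implicit Defensive.

(** With [k = 1] the windmill is a complete split graph: writing [C] for the set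
    of central vertices, two distinct vertices are adjacent exactly when one of
    them lies in [C]. The proof uses only this and the sizes of [C] and [~: C].

    Rule 3 is almost powerless here. While some center is unfilled, the unfilled
    vertices form a single component, and any use of Rule 3 is ordinary forcing
    in the whole graph ([component_center], [cover_center]). Once all centers
    are filled, the components are single leaves; if the player selects at
    least two of them and the oracle returns the whole selection, every filled
    center sees two unfilled vertices and nothing can be forced
    ([no_force_two]). So for [q > 0] the game is ordinary zero forcing, whereas
    for [q = 0] the leaves can be selected and forced one at a time, at no cost
    ([wins0_centers]).

    The lower bounds come from potentials that one token decreases by at most
    one and that forcing never decreases, against the oracle that always returns
    the whole selection ([wins_potential]). A forcing center must have the
    forced vertex as the only unfilled vertex; a forcing leaf must have the
    forced center as the only unfilled center. Hence all centers but one must be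
    paid for and, when [q > 0], also all leaves but one: this is the potential
    [split_debt]. The bound [l] comes from [center_debt]: the free center is
    only available after some leaf has been paid for.

    For the upper bounds, the player fills every vertex but one center [c] and
    one leaf [v]: another leaf forces [c], which then forces [v]. With a single
    leaf, or with [q = 0], the player fills all the centers. *)

(** * The game on an arbitrary graph *)

Section GeneralGame.
Variables (G : sgraph) (q : nat).
Implicit Types (F W A : {set G}) (S : {set {set G}}).

Lemma Zq_eq n :
  wins q n (set0 : {set G}) ->
  (forall t, wins q t (set0 : {set G}) -> n <= t) -> Zq G q = n.
Proof.
move=> win_n min_n; rewrite /Zq; case: ex_minnP => m /asboolP/min_n le_nm min_m.
by apply/eqP; rewrite eqn_leq le_nm andbT min_m //; apply/asboolP.
Qed.

Lemma force_stepP W F F' :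
  reflect (exists x v, [/\ x \in W, x \in F,
             forall w, (w \in W) && (adj x w && (w \notin F)) = (w == v)
             & F' = v |: F])
          (force_step W F F').
Proof.
apply: (iffP existsP) => [[x /existsP[v /andP[/and3P[xW xF /eqP/setP Nx] /eqP->]]]|].
  by exists x, v; split=> // w; have := Nx w; rewrite !inE.
move=> [x [v [xW xF Nx ->]]]; exists x; apply/existsP; exists v.
by rewrite /forces xW xF eqxx andbT; apply/eqP/setP=> w; rewrite !inE Nx.
Qed.

Lemma force_stepT F F' :
  force_step setT F F' ->
  exists x v, [/\ x \in F, v \notin F, adj x v,
    forall w, w \notin F -> adj x w -> w = v & F' = v |: F].
Proof.
case/force_stepP=> x [v [_ xF Nx ->]]; exists x, v.
have := Nx v; rewrite inE eqxx /= => /andP[xv vF]; split=> // w wF xw.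
by apply/eqP; rewrite -Nx inE xw wF.
Qed.

Lemma connect_leq (T : finType) (e : rel T) (f : T -> nat) x y :
  (forall a b, e a b -> f a <= f b) -> connect e x y -> f x <= f y.
Proof.
move=> mono /connectP[p]; elim: p x => [|z p IHp] x /=; first by move=> _ ->.
by case/andP=> /mono le_xz /IHp le_zy /le_zy; apply: leq_trans.
Qed.

Lemma connect_no_step (T : finType) (e : rel T) x y :
  (forall b, ~~ e x b) -> connect e x y -> y = x.
Proof.
by move=> no_step /connectP[[|z p] //= /andP[]]; rewrite (negPf (no_step z)).
Qed.

(** The oracle's strategy of returning the whole selection [S] is built in: only
    the answer [O = S] of the induction hypothesis is ever used, so that Rule 3
    must be checked in the subgraph induced by [F :|: cover S] alone. *)
Lemma wins_potential (f : {set G} -> nat) :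
  f setT = 0 ->
  (forall v F, f F <= (f (v |: F)).+1) ->
  (forall F F', force_step setT F F' -> f F <= f F') ->
  (forall F S F', S \subset components F -> q < #|S| ->
     connect (force_step (F :|: cover S)) F F' -> f F <= f F') ->
  forall t F, wins q t F -> f F <= t.
Proof.
move=> fT f_fill f_force f_oracle t F; elim=> {t F}.
- by move=> t; rewrite fT.
- by move=> t F v _ le_ft; apply: leq_trans (f_fill v F) _.
- by move=> t F F' /f_force le_ff _; apply: leq_trans.
- move=> t F S next SF qS conn _ IH.
  have S0 : S != set0 by rewrite -card_gt0 (leq_ltn_trans _ qS).
  exact: leq_trans (f_oracle _ _ _ SF qS (conn S _ S0)) (IH S _ S0).
Qed.


Lemma wins_fill_set A t : wins q t A -> wins q (#|A| + t) (set0 : {set G}).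
Proof.
suff filled s F : wins q t ([set:: s] :|: F) -> wins q (size s + t) F.
  by move=> win; rewrite cardE; apply: filled; rewrite set_enum setU0.
elim: s F => [|x s IHs] F /=; first by rewrite set_nil set0U.
by rewrite set_cons -setUA setUCA => win; apply: (wins_fill (v := x)); exact: IHs.
Qed.

Lemma wins_last t (x v : G) : adj x v -> wins q t (~: [set v] : {set G}).
Proof.
move=> xv; have xNv : x != v.
  by apply: contraTneq xv => ->; rewrite adj_irr.
apply: (@wins_force _ _ _ _ setT); last exact: wins_done.
apply/force_stepP; exists x, v; split; rewrite ?inE ?setUCr // => w.
by rewrite !inE negbK /=; case: eqP => [->|]; rewrite ?xv ?andbF.
Qed.

End GeneralGame.

(** * Components and forces in complete split graphs *)

Section CompleteSplit.
Variables (G : sgraph) (C : {set G}).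
Hypothesis adjE : forall x y : G,
  adj x y = (x != y) && ((x \in C) || (y \in C)).
Implicit Types (F W U : {set G}) (S : {set {set G}}).

Lemma adj_center x y : x \in C -> x != y -> adj x y.
Proof. by move=> xC xy; rewrite adjE xy xC. Qed.

(** An unfilled center [c] is adjacent to all other unfilled vertices, hence
    connects them. *)
Lemma component_center F U :
  ~~ (C \subset F) -> U \in components F -> U = ~: F.
Proof.
case/subsetPn=> c cC cF /imsetP[x]; rewrite inE => xF ->.
set e := (X in connect X).
have ce y : y \notin F -> connect e c y && connect e y c.
  move=> yF; have [->|yNc] := eqVneq y c; first by rewrite connect0.
  by apply/andP; split; apply: connect1;
    rewrite /e /= cF yF adjE cC ?orbT !andbT ?yNc // eq_sym yNc.
apply/setP=> y; rewrite !inE; case: (boolP (y \in F)) => //= yF.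
have /andP[_ xc] := ce x xF; have /andP[cy _] := ce y yF.
exact: connect_trans xc cy.
Qed.

(** The unfilled vertices are pairwise nonadjacent. *)
Lemma components_singletons F :
  C \subset F -> components F = [set [set x] | x in ~: F].
Proof.
move=> /subsetP CF; apply: eq_in_imset => x; rewrite inE => xF.
apply/setP=> y; rewrite !inE; have [->|yNx] := eqVneq y x.
  by rewrite xF connect0.
apply/negP=> /andP[_ /connect_no_step yx]; move/eqP: yNx; apply.
apply: yx => z /=; apply/negP=> /and3P[xz _ zF]; move: xz.
by rewrite adjE => /andP[_ /orP[] /CF]; apply/negP.
Qed.

Lemma cover_center F S :
  ~~ (C \subset F) -> S \subset components F -> S != set0 ->
  F :|: cover S = setT.
Proof.
move=> CF /subsetP SF /set0Pn[U US].
apply/setP=> x; rewrite !inE; case: (boolP (x \in F)) => //= xF.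
by apply/bigcupP; exists U; rewrite // (component_center CF (SF _ US)) inE.
Qed.

(** A forcing leaf would need an unfilled center, and a forcing center sees the
    leaves [a] and [b] of two distinct selected components. *)
Lemma no_force_two F S F' :
  C \subset F -> S \subset components F -> 1 < #|S| ->
  ~~ force_step (F :|: cover S) F F'.
Proof.
move=> CF; rewrite components_singletons // => /subsetP SF.
case/card_gt1P=> A [B [AS BS AB]].
have /imsetP[a] := SF A AS; rewrite inE => aF Aa.
have /imsetP[b] := SF B BS; rewrite inE => bF Bb.
apply/negP=> /force_stepP[x [v [_ xF Nx _]]].
have := Nx v; rewrite eqxx => /andP[_ /andP[]].
rewrite adjE => /andP[_ /orP[xC | /(subsetP CF) ->]] // _.
have eqv y U : U \in S -> U = [set y] -> y \notin F -> y = v.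
  move=> US Uy yF; apply/eqP; rewrite -Nx yF !inE andbT.
  rewrite adj_center ?andbT //; last by apply: contraNneq yF => <-.
  by apply/orP; right; apply/bigcupP; exists U; rewrite // Uy inE.
by case/eqP: AB; rewrite Aa Bb (eqv a A) // (eqv b B).
Qed.

(** The two alternatives correspond to a force made by a center, which sees all
    the other vertices, and by a filled leaf, which sees exactly the centers. *)
Lemma force_centerP F F' :
  force_step setT F F' ->
  exists2 v, F' = v |: F &
    ~: F = [set v] \/ [/\ C :\: F = [set v], v \in C & ~~ (F \subset C)].
Proof.
case/force_stepT=> x [v [xF vF xv xU ->]]; exists v => //.
case: (boolP (x \in C)) => xC; [left | right].
  apply/setP=> w; rewrite !inE; apply/idP/eqP => [wF | -> //].
  by apply: xU => //; apply: adj_center => //; apply: contraNneq wF => <-.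
have vC : v \in C by move: xv; rewrite adjE (negPf xC) => /andP[].
split=> //; last by apply/subsetPn; exists x.
apply/setP=> w; rewrite !inE; apply/andP/eqP => [[wF wC] | -> //].
apply: xU => //; rewrite adjE wC orbT andbT.
by apply: contraNneq wF => <-.
Qed.

(** * The two potentials *)

(** The debt is one less once a leaf has been filled, because that leaf can
    force the last center. *)
Definition center_debt F := #|C :\: F| - ~~ (F \subset C).

Lemma center_debt0 F : C \subset F -> center_debt F = 0.
Proof. by rewrite -setD_eq0 /center_debt => /eqP->; rewrite cards0. Qed.

(** This is stronger than monotonicity: a force can only happen when the debt is
    already paid. If a center makes the force, all the leaves except possibly
    the forced vertex are filled; the hypothesis on [C] provides a leaf. *)
Lemma center_debt_force F F' :
  C != setT -> force_step setT F F' -> center_debt F = 0.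
Proof.
move=> CT /force_centerP[v _ [Fv|[Cv _ FC]]]; last first.
  by rewrite /center_debt Cv cards1 FC.
have [CF|/subsetPn[c cC cF]] := boolP (C \subset F).
  exact: center_debt0.
have cv : c = v by apply/set1P; rewrite -Fv inE.
have CFv : #|C :\: F| <= 1.
  by rewrite -(cards1 v) -Fv subset_leq_card // setDE subsetIr.
rewrite /center_debt; have /subsetPn[z _ zC] : ~~ (setT \subset C) by rewrite subTset.
suff FC : ~~ (F \subset C) by apply/eqP; rewrite subn_eq0 FC.
apply/subsetPn; exists z => //; apply: contraNT zC => zF.
by have /set1P-> : z \in [set v]; rewrite -?cv // cv -Fv inE.
Qed.

Lemma center_debt_leq q t F : C != setT -> wins q t F -> center_debt F <= t.
Proof.
move=> CT; apply: wins_potential => {t F}.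
- by rewrite center_debt0 ?subsetT.
- move=> v F; rewrite /center_debt.
  have [vC|vC] := boolP (v \in C).
    rewrite subUset sub1set vC /=.
    suff : #|C :\: F| <= #|C :\: (v |: F)|.+1 by lia.
    by rewrite (setUC [set v]) -setDDl (cardsD1 v (C :\: F)); case: (_ \in _).
  rewrite subUset sub1set (negPf vC) /=.
  have -> : C :\: (v |: F) = C :\: F.
    apply/setP=> x; rewrite !inE; case: eqP => // ->.
    by rewrite (negPf vC) !andbF.
  by lia.
- by move=> F F' /center_debt_force->.
- move=> F S F' SF qS.
  have S0 : S != set0 by rewrite -card_gt0 (leq_ltn_trans _ qS).
  have [CF|CF] := boolP (C \subset F); first by rewrite center_debt0.
  rewrite (cover_center CF SF S0); apply: connect_leq => A B.
  by move/center_debt_force->.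
Qed.

(** One center and one leaf may come for free; the truncation of [.-1] matters
    when no center or no leaf is left. *)
Definition split_debt F := #|C :\: F|.-1 + #|~: C :\: F|.-1.

(** A center that makes a force fills the last vertex, when both terms vanish;
    a leaf fills the last unfilled center, which does not change them. *)
Lemma split_debt_force F F' :
  force_step setT F F' -> split_debt F <= split_debt F'.
Proof.
case/force_centerP=> v -> [Fv|[Cv vC _]]; rewrite /split_debt.
  have small (A : {set G}) : #|A :\: F|.-1 = 0.
    have := subset_leq_card (subsetIr A (~: F)).
    by rewrite -setDE Fv cards1; case: #|_| => [|[]].
  by rewrite !small.
rewrite Cv cards1 add0n.
suff -> : ~: C :\: (v |: F) = ~: C :\: F by apply: leq_addl.
apply/setP=> x; rewrite !inE; case: eqP => // ->.
by rewrite vC !andbF.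
Qed.

Lemma split_debt_leq q t F : 0 < q -> wins q t F -> split_debt F <= t.
Proof.
move=> q0; apply: wins_potential => {t F}.
- by rewrite /split_debt !setDT cards0.
- move=> v F; rewrite /split_debt !(setUC [set v]) -!setDDl.
  have := cardsD1 v (C :\: F); have := cardsD1 v (~: C :\: F).
  by rewrite !inE; case: (v \in C); case: (v \in F) => /=; lia.
- exact: split_debt_force.
- move=> F S F' SF qS.
  have S0 : S != set0 by rewrite -card_gt0 (leq_ltn_trans _ qS).
  have [CF|CF] := boolP (C \subset F).
    move/connect_no_step=> -> // B; apply: no_force_two => //.
    exact: leq_ltn_trans q0 qS.
  by rewrite (cover_center CF SF S0); apply: connect_leq; apply: split_debt_force.
Qed.

(** * Values of [Zq] on complete split graphs *)

(** With [q = 0] the player may select a single leaf; the oracle has to return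
    it, and the filled center [c] forces it. *)
Lemma wins0_centers t F : C != set0 -> C \subset F -> wins 0 t F.
Proof.
case/set0Pn=> c cC; elim: {F}#|~: F| {-2}F (erefl #|~: F|) => [|n IHn] F Fn CF.
  have -> : F = setT by rewrite -(setCK F) (cards0_eq Fn) setC0.
  exact: wins_done.
have /card_gt0P[v] : 0 < #|~: F| by rewrite Fn.
rewrite inE => vF.
apply: (@wins_oracle _ _ _ _ [set [set v]] (fun=> v |: F)).
- rewrite sub1set components_singletons //; apply: imset_f.
  by rewrite inE.
- by rewrite cards1.
- move=> O; rewrite subset1 => /orP[/eqP->|->//] _; apply: connect1.
  have cF := subsetP CF _ cC; have cv : c != v by apply: contraNneq vF => <-.
  apply/force_stepP; exists c, v; split; rewrite ?inE ?cF // => w.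
  rewrite /cover big_set1 !inE; case: (eqVneq w v) => [->|wv].
    by rewrite vF orbT adj_center.
  by rewrite orbF; case: (w \in F); rewrite ?andbF.
- move=> O _ _; apply: IHn; last exact: subset_trans CF (subsetUr _ _).
  apply: succn_inj; rewrite -Fn (cardsD1 v (~: F)) inE vF.
  by rewrite setCU setIC -setDE.
Qed.

Lemma Zq_split0 : C != set0 -> C != setT -> Zq G 0 = #|C|.
Proof.
move=> C0 CT; apply: Zq_eq => [|t /(center_debt_leq CT)]; last first.
  by rewrite /center_debt sub0set setD0 subn0.
by rewrite -[#|C|]addn0; apply: wins_fill_set; apply: wins0_centers.
Qed.

Lemma Zq_split1 q : C != set0 -> #|~: C| = 1 -> Zq G q = #|C|.
Proof.
move=> /set0Pn[c cC] /eqP/cards1P[v Cv].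
have vC : v \notin C by rewrite -in_setC Cv set11.
apply: Zq_eq => [|t /center_debt_leq]; last first.
  rewrite /center_debt sub0set setD0 subn0; apply.
  by apply: contraNneq vC => ->.
rewrite -[#|C|]addn0; apply: wins_fill_set; rewrite -(setCK C) Cv.
apply: (@wins_last _ _ _ c); apply: adj_center => //.
by apply: contraNneq vC => <-.
Qed.

Lemma Zq_split_pos q :
  0 < q -> C != set0 -> 1 < #|~: C| -> Zq G q = #|C|.-1 + #|~: C|.-1.
Proof.
move=> q0 /set0Pn[c cC] /card_gt1P[v [x [vC xC vx]]].
apply: Zq_eq => [|t /(split_debt_leq q0)]; last first.
  by rewrite /split_debt !setD0.
rewrite !inE in vC xC.
have cv : c != v by apply: contraNneq vC => <-.
have cx : c != x by apply: contraNneq xC => <-.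
(* Fill all but the center [c] and the leaf [v]; the other leaf [x] forces [c]. *)
have -> : #|C|.-1 + #|~: C|.-1 = #|~: [set c; v]|.
  have := cardsC C; have := cardsC [set c; v]; rewrite cards2 cv.
  have := cardsD1 c C; have := cardsD1 v (~: C); rewrite !inE cC vC.
  by lia.
rewrite -[#|_|]addn0; apply: wins_fill_set.
apply: (@wins_force _ _ _ _ (~: [set v])); last first.
  by apply: (@wins_last _ _ _ c); apply: adj_center.
apply/force_stepP; exists x, c; split; rewrite ?inE //.
- by rewrite negb_or eq_sym cx eq_sym vx.
- move=> w; rewrite !inE negbK /= adjE (negPf xC) /=.
  case: (eqVneq w c) => [->|_]; first by rewrite eq_sym cx cC.
  by case: (eqVneq w v) => [->|_]; rewrite ?(negPf vC) ?andbF.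
- apply/setP=> w; rewrite !inE; case: (eqVneq w c) => [->|] //=.
Qed.

End CompleteSplit.

(** * Windmills of single vertices *)

Definition centers eta l : {set windmill1 eta 1 l} := inr @: [set: 'I_l].

Lemma mem_centers eta l (x : windmill1 eta 1 l) :
  (x \in centers eta l) = if x is inr _ then true else false.
Proof.
case: x => [p|c]; last by rewrite imset_f.
by apply/imsetP=> -[].
Qed.

Lemma windmill_split eta l (x y : windmill1 eta 1 l) :
  adj x y = (x != y) && ((x \in centers eta l) || (y \in centers eta l)).
Proof.
rewrite !mem_centers; case: x y => [[i a]|c] [[j b]|d] //=.
- by rewrite !ord1 eqxx !andbF.
- by rewrite andbT (inj_eq (@inr_inj _ _)).
Qed.

Lemma card_centers eta l : #|centers eta l| = l.
Proof. by rewrite card_imset ?cardsT ?card_ord //; apply: inr_inj. Qed.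

Lemma card_leaves eta l : #|~: centers eta l| = eta.
Proof.
have := cardsC (centers eta l); rewrite card_centers.
by rewrite card_sum card_prod !card_ord muln1 addnC => /addIn.
Qed.

Theorem theorem4p3 (eta l : nat) (heta : 1 <= eta) (hl : 1 <= l) (q : nat) :
  [/\ eta = 1 -> Zq (windmill1 eta 1 l) q = l,
      0 < q -> 1 < eta -> Zq (windmill1 eta 1 l) q = l + eta - 2
    & q = 0 -> Zq (windmill1 eta 1 l) q = l].
Proof.
have adjE := @windmill_split eta l.
have C0 : centers eta l != set0 by rewrite -card_gt0 card_centers.
split=> [eta1 | q0 eta2 | ->].
- by rewrite (Zq_split1 adjE) ?card_leaves // card_centers.
- by rewrite (Zq_split_pos adjE) ?card_leaves // card_centers; lia.
- rewrite (Zq_split0 adjE) ?card_centers //.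
  by apply: contraTneq heta => CT; rewrite -(card_leaves eta l) CT setCT cards0.
Qed.
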